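(* For every integer $k$ there is a finite connected graph $G$ with $\operatorname{idw}(G)=1$ such that every spanning tree of $G$ has cycle-distortion at least $k$.
   Context: A tree-decomposition of $G$ is a pair $(T,(B_t:t\in V(T)))$ where $T$ is a tree and $B_t\subseteq V(G)$, such that $V(G)=\bigcup_t B_t$; every edge has both ends in some $B_t$; and if $t_2$ lies on the $T$-path between $t_1,t_3$ then $B_{t_1}\cap B_{t_3}\subseteq B_{t_2}$. Its inner diameter is the maximum over $t$ of the diameter of $G[B_t]$ ($\infty$ if some $G[B_t]$ is disconnected), and $\operatorname{idw}(G)$ is the minimum inner diameter over all tree-decompositions of $G$. The cycle-distortion of a spanning tree $T$ of $G$ is the maximum, over all edges $uv$ of $G$, of the length of the path of $T$ between $u$ and $v$. *)

(* Defs.v *)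
From mathcomp Require Import all_boot all_order all_algebra.
From mathcomp Require Import boolp classical_sets.

Set Implicit Arguments.
Unset Strict Implicit.
Unset Printing Implicit Defensive.

Local Open Scope classical_set_scope.

Inductive enat : Type := Fin of nat | Infty.

Definition ele (a b : enat) : bool :=
  match a, b with
  | _, Infty => true
  | Infty, Fin _ => false
  | Fin m, Fin n => m <= n
  end.

Definition int_le_enat (k : int) (d : enat) : bool :=
  if d is Fin n then (k <= n%:Z)%R else true.

(* The order on [enat] is a well-order, so the infimum of a nonempty set is its
   minimum; the infimum of the empty set is [Infty]. *)
Definition einf (A : set enat) : enat :=
  match pselect (exists n, `[< A (Fin n) >]) with
  | left h => Fin (ex_minn h)
  | right _ => Infty
  end.

(* This is the maximum of [A] when [A] is nonempty and either bounded by some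
   [Fin n] or contains [Infty] (always the case below for the invariants of a
   finite graph); the supremum of the empty set is [Fin 0]. *)
Definition esup (A : set enat) : enat :=
  einf [set m | forall d, A d -> ele d m].

Record sgraph (V : Type) := SGraph {
  edge :> rel V;
  edge_sym : symmetric edge;
  edge_irr : irreflexive edge
}.

Definition walk (V : Type) (G : sgraph V) (x : V) (p : seq V) (y : V) : Prop :=
  path G x p /\ last x p = y.

Definition simple_path (V : eqType) (G : sgraph V) (x : V) (p : seq V) (y : V)
    : Prop :=
  walk G x p y /\ uniq (x :: p).

Definition connected (V : Type) (G : sgraph V) : Prop :=
  inhabited V /\ forall x y : V, exists p, walk G x p y.

Definition acyclic (V : eqType) (G : sgraph V) : Prop :=
  forall c : seq V, 3 <= size c -> ~ ucycle G c.

Definition is_tree (V : eqType) (T : sgraph V) : Prop :=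
  connected T /\ acyclic T.

Definition dist (V : Type) (G : sgraph V) (x y : V) : enat :=
  einf [set Fin (size p) | p in [set p | walk G x p y]].

(* [Infty] when [G] is disconnected. *)
Definition diam (V : Type) (G : sgraph V) : enat :=
  esup [set d | exists x y : V, d = dist G x y].

Section Induced.
Variables (V : finType) (G : sgraph V) (B : {set V}).

Definition induced_edge : rel {x : V | x \in B} :=
  fun x y => G (val x) (val y).

Lemma induced_sym : symmetric induced_edge.
Proof. by move=> x y; apply: edge_sym. Qed.

Lemma induced_irr : irreflexive induced_edge.
Proof. by move=> x; apply: edge_irr. Qed.

Definition induced : sgraph {x : V | x \in B} := SGraph induced_sym induced_irr.
End Induced.

(* The decomposition tree may be infinite. *)
Record tree_decomposition (V : finType) (G : sgraph V) (I : eqType)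
    (T : sgraph I) (B : I -> {set V}) : Prop := TreeDecomposition {
  td_tree : is_tree T;
  td_vertex : forall v : V, exists t, v \in B t;
  td_edge : forall u v : V, G u v -> exists t, u \in B t /\ v \in B t;
  td_path : forall (t1 t2 t3 : I) (p : seq I),
    simple_path T t1 p t3 -> t2 \in t1 :: p -> B t1 :&: B t3 \subset B t2
}.

Definition inner_diameter (V : finType) (G : sgraph V) (I : eqType)
    (B : I -> {set V}) : enat :=
  esup [set d | exists t : I, d = diam (induced G (B t))].

Definition idw (V : finType) (G : sgraph V) : enat :=
  einf [set d | exists (I : eqType) (T : sgraph I) (B : I -> {set V}),
         tree_decomposition G T B /\ d = inner_diameter G B].

(* The vertex set of [T] is all of [V], so [T] spans [G]. *)
Definition spanning_tree (V : eqType) (G T : sgraph V) : Prop :=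
  is_tree T /\ subrel T G.

Definition cycle_distortion (V : eqType) (G T : sgraph V) : enat :=
  esup [set d | exists u v p,
         [/\ G u v, simple_path T u p v & d = Fin (size p)]].

(* Main.v *)
(* Take the vertices 0, ..., 2^(2K) and join the two ends of every dyadic
   interval. This graph is a triangulated polygon whose dual is the binary tree
   of dyadic intervals, so the triangles form a tree-decomposition into cliques.
   Let T be a spanning tree. If the ends of every interval of length 2^K are
   joined by a path of T inside that interval, concatenating these paths gives a
   simple path of T between the adjacent vertices 0 and 2^(2K), of length at
   least 2^K. Otherwise all paths of T between the ends of some interval of
   length 2^K leave it. The same then holds for one of its halves, and a path of
   T between the ends of that half has to go through the third corner of the
   triangle, so it is longer by at least one than a path joining the ends of the
   whole interval. Halving K times gives an edge whose ends are at distance at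
   least K in T. *)
Require Import Defs.
From mathcomp Require Import all_boot all_order all_algebra.
From mathcomp Require Import boolp classical_sets zify.

Set Implicit Arguments.
Unset Strict Implicit.
Unset Printing Implicit Defensive.

Import GRing.Theory Num.Theory.

(** * Order, infima and suprema of extended naturals *)

Lemma ele_anti (a b : enat) : ele a b -> ele b a -> a = b.
Proof.
case: a b => [m|] [n|] //= mn nm; congr Fin.
by apply/eqP; rewrite eqn_leq mn.
Qed.

Lemma einf_le (A : set enat) (d : enat) : A d -> ele (einf A) d.
Proof.
move=> Ad; rewrite /einf; case: pselect => [h|h].
  case: d Ad => [n|] Ad //=.
  by case: ex_minnP => m _; apply; apply/asboolP.
by case: d Ad => [n|] Ad //=; case: h; exists n; apply/asboolP.
Qed.

Lemma le_einf (A : set enat) (m : enat) :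
  (forall d, A d -> ele m d) -> ele m (einf A).
Proof.
move=> mA; rewrite /einf; case: pselect => [h|_]; last by case: (m).
by case: ex_minnP => n /asboolP An _; apply: mA.
Qed.

Lemma le_esup (A : set enat) (d : enat) : A d -> ele d (esup A).
Proof. by move=> Ad; apply: le_einf => m; apply. Qed.

Lemma esup_le (A : set enat) (m : enat) :
  (forall d, A d -> ele d m) -> ele (esup A) m.
Proof. by move=> Am; apply: einf_le. Qed.

Lemma ele_trans (b a c : enat) : ele a b -> ele b c -> ele a c.
Proof. by case: a b c => [a|] [b|] [c|] //=; apply: leq_trans. Qed.

(** * Decompositions into cliques and inner diameter width 1 *)

Section InnerDiameter.
Variables (V : finType) (G : sgraph V).

Lemma diam_clique (B : {set V}) :
  {in B &, forall x y, x != y -> G x y} -> ele (diam (induced G B)) (Fin 1).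
Proof.
move=> cliqueB; apply: esup_le => _ [x [y ->]].
have [<-|xy] := eqVneq x y.
  by apply: (@ele_trans (Fin 0)) => //; apply: einf_le; exists [::].
apply: einf_le; exists [:: y] => //; split=> //=; rewrite andbT.
by apply: cliqueB; rewrite ?(valP x) ?(valP y).
Qed.

(** Some bag contains both ends of the edge, which are at distance at least 1. *)
Lemma inner_diameter_ge1 (I : eqType) (T : sgraph I) (B : I -> {set V}) u v :
  G u v -> tree_decomposition G T B -> ele (Fin 1) (inner_diameter G B).
Proof.
move=> Guv [_ _ /(_ u v Guv) [t [uB vB]] _].
apply: (@ele_trans (diam (induced G (B t)))); last by apply: le_esup; exists t.
apply: (@ele_trans (dist (induced G (B t)) (exist _ u uB) (exist _ v vB))).
  apply: le_einf => _ [[|z p] [_ uv] <-] //=.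
  by case: uv => uv; rewrite uv edge_irr in Guv.
by apply: le_esup; exists (exist _ u uB), (exist _ v vB).
Qed.

Lemma idw_eq1 (I : eqType) (T : sgraph I) (B : I -> {set V}) u v :
  G u v -> tree_decomposition G T B ->
  (forall t, {in B t &, forall x y, x != y -> G x y}) -> idw G = Fin 1.
Proof.
move=> Guv tdB cliqueB; apply: ele_anti.
  apply: (@ele_trans (inner_diameter G B)).
    by apply: einf_le; exists I, T, B.
  by apply: esup_le => _ [t ->]; apply: diam_clique.
apply: le_einf => _ [J [U [C [tdC ->]]]].
exact: inner_diameter_ge1 Guv tdC.
Qed.

End InnerDiameter.

(** * Walks, simple paths, and separation by few vertices *)

Section Walks.
Variables (V : eqType) (G : sgraph V).

Lemma walk_trans x y z p q :
  walk G x p y -> walk G y q z -> walk G x (p ++ q) z.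
Proof. by move=> [xp <-] [yq <-]; split; rewrite ?cat_path ?last_cat ?xp. Qed.

Lemma simple_path_of_walk x p y : walk G x p y -> exists q, simple_path G x q y.
Proof.
case=> xp <-; case/shortenP: xp => q xq uq _.
by exists q; split.
Qed.

Lemma walk_rev x p y :
  walk G x p y -> exists2 q, walk G y q x & y :: q = rev (x :: p).
Proof.
case=> xp <-; exists (rev (belast x p)); last first.
  by rewrite (lastI x p) rev_rcons.
split; last by case: p xp => //= z p _; rewrite rev_cons last_rcons.
rewrite rev_path; apply: sub_path xp => a b; by rewrite edge_sym.
Qed.

Lemma simple_path_rev x p y :
  simple_path G x p y -> exists2 q, simple_path G y q x & y :: q = rev (x :: p).
Proof.
case=> /walk_rev[q yq eq] up; exists q => //; split=> //.
by rewrite eq rev_uniq.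
Qed.

Lemma path_exit (D : pred V) x p :
  path G x p -> D x -> ~~ D (last x p) ->
  exists p1 y p2, [/\ p = p1 ++ y :: p2, G (last x p1) y, D (last x p1) & ~~ D y].
Proof.
elim: p x => [|y p IHp] x /=; first by move=> _ ->.
case/andP=> xy yp Dx; have [Dy|nDy] := boolP (D y) => nD.
  have [p1 [z [p2 [-> ? ? ?]]]] := IHp _ yp Dy nD.
  by exists (y :: p1), z, p2.
by exists [::], y, p.
Qed.

Lemma path_exit_mem (D : pred V) x p :
  path G x p -> D x -> ~~ D (last x p) ->
  exists y z, [/\ y \in belast x p, z \in p, G y z, D y & ~~ D z].
Proof.
move=> xp Dx nD; have [p1 [z [p2 [-> Gz Dy nDz]]]] := path_exit xp Dx nD.
exists (last x p1), z; split=> //; last by rewrite mem_cat inE eqxx orbT.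
by rewrite belast_cat mem_cat /= inE eqxx orbT.
Qed.

(* A path leaving [D] and coming back would visit the gate [c] twice. *)
Lemma simple_path_gate (D : pred V) c x p y z :
  (forall a b, G a b -> D a -> ~~ D b -> a = c) ->
  simple_path G x p y -> D x -> D y -> z \in x :: p -> D z.
Proof.
move=> gate [[xp <-] up] Dx Dy zp; apply: contraT => nDz; move: zp.
rewrite inE => /orP[/eqP zx|]; first by rewrite zx Dx in nDz.
move=> /splitPr zp; case: zp xp up Dy => p1 p2.
rewrite last_cat cat_path /= => /and3P[xp1 xz zp2] up Dy.
have xp1z : path G x (rcons p1 z) by rewrite rcons_path xp1.
have [|a [b [ap1 _ Gab Da nDb]]] := path_exit_mem (D := D) xp1z Dx.
  by rewrite last_rcons.
have [|a' [b' [_ bp2 Gab' Da' nDb']]] := path_exit_mem (D := predC D) zp2 nDz.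
  by rewrite /= negbK.
have ac := gate _ _ Gab Da nDb; rewrite /= negbK in nDb'.
have bc : b' = c by apply: gate nDb' Da'; rewrite edge_sym.
move: ap1; rewrite belast_rcons ac => cp1; rewrite bc in bp2.
have {up} : uniq ((x :: p1) ++ z :: p2) by [].
rewrite cat_uniq => /and3P[_ /hasPn/(_ c) + _].
by rewrite inE bp2 orbT cp1 => /(_ isT).
Qed.

(* [O] is the inside of a triangle with corners [u], [m], [w], cut at [m] into
   [O1], next to [u], and the part next to [w]. *)
Lemma simple_path_detour (O O1 : pred V) u m w p z L :
  (forall a b, G a b -> ~~ O a -> O b -> a = u \/ a = w) ->
  (forall a b, G a b -> ~~ O1 a -> O1 b -> a = u \/ a = m) ->
  O m -> ~~ O1 w -> u != m -> u != w ->
  simple_path G w p m -> z \in w :: p -> z != w -> [|| ~~ O z, O1 z | z == u] ->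
  (forall q, simple_path G w q u -> L <= size q) -> L < size p.
Proof.
move=> gateO gateO1 Om nO1w um uw [[wp lp] up] zp zw zO farL.
have {zp zw} zp : z \in p by move: zp; rewrite inE (negPf zw).
have {z zp zO} : u \in p.
  have [/eqP <- //|zu] := boolP (z == u); rewrite (negPf zu) orbF in zO.
  move/splitPr: zp => zp; case: zp wp up lp => p1 p2.
  rewrite last_cat cat_path /= => /and3P[xp1 xz zp2] up lp.
  (* The part before [z] enters [O1] from [u] or [m], and [m] comes only at the end of the path. *)
  have [O1z|nO1z] := boolP (O1 z).
    have xp1z : path G w (rcons p1 z) by rewrite rcons_path xp1.
    have [|a [b [ap1 _ Gab Da nDb]]] :=
      path_exit_mem (D := predC O1) xp1z nO1w.
      by rewrite last_rcons /= negbK.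
    rewrite /= negbK in nDb; rewrite belast_rcons in ap1.
    case: (gateO1 _ _ Gab Da nDb) => am; rewrite am in ap1.
      by move: ap1; rewrite inE (negPf uw) /= mem_cat => ->.
    have mp2 : m \in z :: p2 by rewrite -lp mem_last.
    have {up} : uniq ((w :: p1) ++ z :: p2) by [].
    rewrite cat_uniq => /and3P[_ /hasPn/(_ _ mp2) + _].
    by rewrite /= ap1.
  rewrite (negPf nO1z) orbF in zO.
  (* The part after [z] returns into [O] from [u] or [w], and [w] is the start of the path. *)
  have [|a [b [ap2 _ Gab Da nDb]]] := path_exit_mem (D := predC O) zp2 zO.
    by rewrite lp /= negbK.
  rewrite /= negbK in nDb; move/mem_belast in ap2.
  case: (gateO _ _ Gab Da nDb) => aw; rewrite aw in ap2.
    by rewrite mem_cat ap2 orbT.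
  by move: up => /=; rewrite mem_cat ap2 orbT.
(* The part up to [u] has length at least [L], and since [u != m] one more edge follows. *)
move=> /splitPr up'; case: up' wp up lp => p1 p2.
rewrite last_cat cat_path /= => /and3P[wp1 wu _] up lp.
have : L <= size (rcons p1 u).
  apply: farL; split; first by split; rewrite ?last_rcons // rcons_path wp1.
  have {up} : uniq (w :: (p1 ++ u :: p2)) by [].
  by rewrite -cat_rcons -cat_cons cat_uniq => /andP[].
rewrite size_rcons size_cat /=; case: p2 lp {up} => [/= lp|? ? _ /=]; last by lia.
by rewrite lp eqxx in um.
Qed.

End Walks.

(** * Rootless trees given by a parent map that raises the rank by one *)

Section ParentTree.
Variables (I : eqType) (par : I -> I) (rk : I -> nat).
Hypothesis rk_par : forall x, rk (par x) = (rk x).+1.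

Definition parent_edge : rel I := fun x y => (y == par x) || (x == par y).

Lemma parent_edge_sym : symmetric parent_edge.
Proof. by move=> x y; rewrite /parent_edge orbC. Qed.

Lemma parent_edge_irr : irreflexive parent_edge.
Proof.
move=> x; rewrite /parent_edge orbb; apply/negP => /eqP xE.
by have := rk_par x; rewrite -xE; lia.
Qed.

Definition parent_graph : sgraph I := SGraph parent_edge_sym parent_edge_irr.

Lemma walk_ancestor x m : exists p, walk parent_graph x p (iter m par x).
Proof.
elim: m => [|m [p xp]]; first by exists [::].
exists (p ++ [:: par (iter m par x)]); apply: walk_trans xp _.
by split=> //=; rewrite /parent_edge eqxx.
Qed.

Lemma seq_argmin (c : seq I) :
  c != [::] -> exists2 x, x \in c & {in c, forall y, rk x <= rk y}.
Proof.
elim: c => [//|x c IHc] _; case: c IHc => [_|y c /(_ isT) [z zc zmin]].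
  by exists x => [|y]; rewrite inE // => /eqP ->.
have [xz|zx] := leqP (rk x) (rk z).
  exists x; first by rewrite inE eqxx.
  move=> t; rewrite inE => /orP[/eqP -> //|/zmin]; exact: leq_trans.
exists z; first by rewrite inE zc orbT.
by move=> t; rewrite inE => /orP[/eqP ->|/zmin //]; apply: ltnW.
Qed.

(* Both neighbours on a cycle of a vertex of minimal rank are its parent. *)
Lemma parent_graph_acyclic : acyclic parent_graph.
Proof.
move=> c c3 /andP[cyc uc].
have [|x xc xmin] := @seq_argmin c; first by case: (c) c3.
have up y : y \in c -> parent_edge x y -> y = par x.
  move=> yc /orP[/eqP //|/eqP xy]; have := xmin y yc.
  by rewrite xy rk_par ltnn.
have [k c' cE] := rot_to xc.
have subc y : y \in c' -> y \in c.
  by move=> yc; rewrite -(mem_rot k) cE inE yc orbT.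
move: cyc uc c3; rewrite -(rot_cycle k) -(rot_uniq k) -(size_rot k) cE.
case/lastP: c' cE subc => [//|c' z] cE subc; case: c' cE subc => [//|y c'] cE subc.
rewrite /= rcons_path last_rcons => /and3P[xy _ zx] /and3P[_ yc' _] _.
have yE : y = par x by apply: up xy; apply: subc; rewrite /= inE eqxx.
have zE : z = par x.
  apply: up; last by rewrite parent_edge_sym.
  by apply: subc; rewrite mem_rcons inE eqxx.
by move: yc'; rewrite mem_rcons inE yE zE eqxx.
Qed.

Lemma parent_graph_tree :
  inhabited I -> (forall x y, exists m n, iter m par x = iter n par y) ->
  is_tree parent_graph.
Proof.
move=> inI common; split; last exact: parent_graph_acyclic.
split=> // x y; have [m [n xy]] := common x y.
have [p xp] := walk_ancestor x m; have [q yq] := walk_ancestor y n.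
by have [r r' _] := walk_rev yq; exists (p ++ r); apply: walk_trans xp _; rewrite xy.
Qed.

Definition descendant (t : I) : pred I := fun x => `[< exists m, iter m par x = t >].

Lemma descendantxx t : descendant t t.
Proof. by apply/asboolP; exists 0. Qed.

Lemma descendant_par t x : descendant t (par x) -> descendant t x.
Proof. by move=> /asboolP[m xt]; apply/asboolP; exists m.+1; rewrite iterSr. Qed.

Lemma descendant_eq_or_par t x : descendant t x -> x = t \/ descendant t (par x).
Proof.
move=> /asboolP[[|m] xt]; [by left | right].
by apply/asboolP; exists m; rewrite -iterSr.
Qed.

Lemma descendant_rk t x : descendant t x -> rk x <= rk t.
Proof.
move=> /asboolP[m <-]; elim: m => //= m IHm.
by rewrite rk_par; apply: leqW.
Qed.

(** The only edge leaving the descendants of [t] joins [t] to its parent, so [t] is a gate. *)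
Lemma simple_path_in_descendants t x p y z :
  simple_path parent_graph x p y -> descendant t x -> descendant t y ->
  z \in x :: p -> descendant t z.
Proof.
apply: (@simple_path_gate _ _ _ t) => a b /orP[/eqP-> /descendant_eq_or_par[//|->//]|].
by move=> /eqP-> /descendant_par ->.
Qed.

(** Seen from the complement, the gate is [par t]. *)
Lemma simple_path_out_descendants t x p y z :
  simple_path parent_graph x p y -> ~~ descendant t x -> ~~ descendant t y ->
  z \in x :: p -> ~~ descendant t z.
Proof.
apply: (@simple_path_gate _ _ (predC (descendant t)) (par t)) => a b /= ab na.
rewrite negbK => db; case/orP: ab => /eqP ab.
  by rewrite ab in db; rewrite (descendant_par db) in na.
by case: (descendant_eq_or_par db) => [<- //|]; rewrite -ab (negPf na).
Qed.

End ParentTree.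

(** * The dyadic graph and its tree-decomposition into triangles *)

Definition dyadic (u v : nat) : Prop := exists i j, u = j * 2 ^ i /\ v = j.+1 * 2 ^ i.

Lemma dyadic_lt u v : dyadic u v -> u < v.
Proof. by move=> [i [j [-> ->]]]; rewrite ltn_pmul2r ?expn_gt0. Qed.

Section DyadicGraph.
Variable M : nat.

Definition dyadic_edge : rel 'I_M.+1 := fun u v => `[< dyadic u v \/ dyadic v u >].

Lemma dyadic_edge_sym : symmetric dyadic_edge.
Proof. by move=> u v; apply: asbool_equiv_eq; split; case; auto. Qed.

Lemma dyadic_edge_irr : irreflexive dyadic_edge.
Proof. by move=> u; apply/negP => /asboolP[] /dyadic_lt; rewrite ltnn. Qed.

Definition dyadic_graph : sgraph 'I_M.+1 := SGraph dyadic_edge_sym dyadic_edge_irr.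

Lemma dyadic_graph_connected : connected dyadic_graph.
Proof.
split; first exact: (inhabits ord0).
suff from0 (u : 'I_M.+1) : exists p, walk dyadic_graph ord0 p u.
  move=> x y; have [p px] := from0 x; have [q qy] := from0 y.
  by have [r rx _] := walk_rev px; exists (r ++ q); apply: walk_trans rx qy.
case: u => n; elim: n => [|n IHn] nM.
  by exists [::]; split => //; apply: val_inj.
have [p pn] := IHn (ltnW nM); exists (p ++ [:: Ordinal nM]).
apply: walk_trans pn _; split=> //=; rewrite andbT; apply/asboolP; left.
by exists 0, n; rewrite !muln1.
Qed.

(* The node [(i, j)] stands for the interval [j 2^(i+1), (j+1) 2^(i+1)], and
   its bag consists of the two ends and the midpoint. *)
Definition dyadic_par (t : nat * nat) : nat * nat := (t.1.+1, t.2 %/ 2).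

Definition dyadic_bag (t : nat * nat) : {set 'I_M.+1} :=
  [set v : 'I_M.+1 | (2 ^ t.1 %| v) && (t.2 * 2 ^ t.1.+1 <= v <= t.2.+1 * 2 ^ t.1.+1)].

Lemma iter_dyadic_par m t : iter m dyadic_par t = (t.1 + m, t.2 %/ 2 ^ m).
Proof.
elim: m => [|m IHm] /=; first by rewrite addn0 divn1; case: t.
by rewrite IHm /dyadic_par /= addnS -divnMA expnSr.
Qed.

Definition dyadic_tree : sgraph (nat * nat)%type :=
  @parent_graph _ dyadic_par fst (fun=> erefl).

Lemma dyadic_tree_is_tree : is_tree dyadic_tree.
Proof.
apply: parent_graph_tree; first exact: (inhabits (0, 0)).
(* Both nodes climb to level [i1 + i2 + j1 + j2], high enough for both indices to become 0. *)
move=> [i1 j1] [i2 j2]; exists (i2 + (j1 + j2)), (i1 + (j1 + j2)).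
rewrite !iter_dyadic_par /=; congr pair; first by lia.
have lt2 n k : n <= k -> n < 2 ^ k by move=> nk; apply: leq_ltn_trans nk (ltn_expl _ _).
by rewrite !divn_small //; apply: lt2; lia.
Qed.

Lemma dyadic_interval_par m i j v :
  j * 2 ^ i.+1 <= v <= j.+1 * 2 ^ i.+1 ->
  (j %/ 2 ^ m) * 2 ^ (i + m).+1 <= v <= (j %/ 2 ^ m).+1 * 2 ^ (i + m).+1.
Proof.
move=> /andP[jv vj]; rewrite -addSn addnC expnD !mulnA; apply/andP; split.
  by apply: leq_trans jv; rewrite leq_mul2r leq_trunc_div orbT.
by apply: leq_trans vj _; rewrite leq_mul2r ltn_ceil ?expn_gt0 ?orbT.
Qed.

Lemma dyadic_tree_decomposition :
  tree_decomposition dyadic_graph dyadic_tree dyadic_bag.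
Proof.
have edge_bag (u v : 'I_M.+1) : dyadic u v ->
    exists t, u \in dyadic_bag t /\ v \in dyadic_bag t.
  (* The edge spans one half of the interval of [(i, j %/ 2)], which has length [2 ^ i.+1]. *)
  move=> [i [j [uE vE]]]; exists (i, j %/ 2); rewrite !inE uE vE !dvdn_mull //=.
  rewrite expnS; set q := 2 ^ i; nia.
split; first exact: dyadic_tree_is_tree.
- move=> v; exists (0, v %/ 2); rewrite inE /= dvd1n /= expn1; lia.
- move=> u v /asboolP[/edge_bag //|/edge_bag[t [? ?]]]; by exists t.
move=> t1 t2 t3 p tp t2p; apply/fintype.subsetP => v; rewrite !inE.
case: t2 t2p => i j t2p /andP[/andP[d1 v1] /andP[d3 v3]] /=.
(* If [v] is outside the interval of [(i, j)], it is in no bag of a descendant, so the path between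
   [t1] and [t3] avoids [(i, j)]. *)
have [vI|nvI] := boolP (j * 2 ^ i.+1 <= v <= j.+1 * 2 ^ i.+1); last first.
  have out t : t.2 * 2 ^ t.1.+1 <= v <= t.2.+1 * 2 ^ t.1.+1 ->
      ~~ descendant dyadic_par (i, j) t.
    move=> vt; apply: contra nvI => /asboolP[m].
    by rewrite iter_dyadic_par => -[<- <-]; apply: dyadic_interval_par.
  have := simple_path_out_descendants tp (out _ v1) (out _ v3) t2p.
  by rewrite descendantxx.
rewrite andbT; case: i t2p {vI} => [|i] t2p; first by rewrite dvd1n.
apply: contraT => ndv.
(* As [2 ^ i.+1] does not divide [v], all bags containing [v] have level at most [i] and lie below
   the one node of level [i] whose interval contains [v]. The path stays there and cannot reach
   level [i.+1]. *)
have inD t : 2 ^ t.1 %| v -> t.2 * 2 ^ t.1.+1 <= v <= t.2.+1 * 2 ^ t.1.+1 ->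
    descendant dyadic_par (i, v %/ 2 ^ i.+1) t.
  case: t => i' j' /= dv vt; have i'i : i' <= i.
    by rewrite leqNgt; apply: contra ndv => ii'; apply: dvdn_trans dv; apply: dvdn_exp2l.
  apply/asboolP; exists (i - i'); rewrite iter_dyadic_par /= subnKC //; congr pair.
  have := dyadic_interval_par (i - i') vt; rewrite subnKC //.
  set c := j' %/ _ => /andP[cv vc].
  apply/eqP; rewrite eqn_leq leq_divRL ?expn_gt0 // cv /=.
  rewrite -ltnS ltn_divLR ?expn_gt0 // ltn_neqAle vc andbT.
  by apply: contra ndv => /eqP ->; apply: dvdn_mull.
have := simple_path_in_descendants tp (inD _ d1 v1) (inD _ d3 v3) t2p.
by move/(@descendant_rk _ dyadic_par fst (fun=> erefl)) => /=; rewrite ltnn.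
Qed.

(** In units of [2 ^ i] the bag lies in [{2j, 2j+1, 2j+2}]: two members span a half or the whole
    interval. *)
Lemma dyadic_bag_clique t :
  {in dyadic_bag t &, forall u v, u != v -> dyadic_graph u v}.
Proof.
have lt_clique (u v : 'I_M.+1) : u \in dyadic_bag t -> v \in dyadic_bag t ->
    u < v -> dyadic u v.
  case: t => i j; rewrite !inE /= expnS.
  move=> /andP[/dvdnP[c ->] /andP[jc _]] /andP[/dvdnP[d ->] /andP[_ dj]].
  rewrite ltn_pmul2r ?expn_gt0 // => cd.
  have q0 : 0 < 2 ^ i by rewrite expn_gt0.
  have {jc} jc : j * 2 <= c by rewrite -(leq_pmul2r q0) -mulnA.
  have {dj} dj : d <= j.+1 * 2 by rewrite -(leq_pmul2r q0) -mulnA.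
  have [dE|dE] : d = c.+1 \/ (c = j * 2 /\ d = j.+1 * 2) by lia.
    by exists i, c; rewrite dE.
  by case: dE => -> ->; exists i.+1, j; rewrite expnS !mulnA.
move=> u v ub vb; rewrite -val_eqE neq_ltn => /orP[uv|vu]; apply/asboolP.
  by left; apply: lt_clique.
by right; apply: lt_clique.
Qed.

Lemma idw_dyadic_graph : 0 < M -> idw dyadic_graph = Fin 1.
Proof.
move=> M0; apply: (@idw_eq1 _ _ _ dyadic_tree dyadic_bag ord0 (Ordinal (M0 : 1 < M.+1))).
- by apply/asboolP; left; exists 0, 0.
- exact: dyadic_tree_decomposition.
- exact: dyadic_bag_clique.
Qed.
End DyadicGraph.

(** * Long paths in connected subgraphs of the dyadic graph *)

Section DyadicSubgraph.
Variables (M : nat) (T : sgraph 'I_M.+1).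
Hypothesis TG : subrel T (dyadic_graph M).

Definition inside i j : pred 'I_M.+1 := fun z => j * 2 ^ i <= z <= j.+1 * 2 ^ i.
Definition interior i j : pred 'I_M.+1 := fun z => j * 2 ^ i < z < j.+1 * 2 ^ i.
Definition ends i j (u v : 'I_M.+1) : Prop :=
  u = j * 2 ^ i :> nat /\ v = j.+1 * 2 ^ i :> nat.

(** Dyadic intervals do not cross, so an edge with one end strictly inside an interval stays within
    it. *)
Lemma edge_interior i j (x y : 'I_M.+1) :
  T x y -> ~~ interior i j x -> interior i j y ->
  x = j * 2 ^ i :> nat \/ x = j.+1 * 2 ^ i :> nat.
Proof.
rewrite /interior => /TG/asboolP xy nx yI.
suff : j * 2 ^ i <= x <= j.+1 * 2 ^ i by lia.
have {nx xy} [k [c [cx cy]]] : exists k c,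
    c * 2 ^ k <= x <= c.+1 * 2 ^ k /\ (y = c * 2 ^ k :> nat \/ y = c.+1 * 2 ^ k :> nat).
  by case: xy => -[k [c [-> ->]]]; exists k, c; split;
    rewrite ?leqnn ?leq_mul2r ?leqnSn ?orbT; auto.
(* [y] is strictly between consecutive multiples of [2 ^ i], which forces the level [k] of the edge
   below [i]. *)
have nmul e : (e * 2 ^ i == y) = false.
  apply/negP => /eqP ey; move: yI; rewrite -ey !ltn_pmul2r ?expn_gt0 //; lia.
have [ik|/ltnW ki] := leqP i k.
  case: cy => yE; have := nmul ((y %/ 2 ^ i)); rewrite divnK ?eqxx // yE;
    by apply: dvdn_mull; apply: dvdn_exp2l.
have q0 : 0 < 2 ^ k by rewrite expn_gt0.
move: cx yI; rewrite -(subnK ki) expnD !mulnA; move: (2 ^ (i - k)) => r.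
move: (j * r) (j.+1 * r) => A B /andP[cx xc] /andP[Ay yB].
have [Ac cB] : A <= c /\ c.+1 <= B.
  by case: cy => yE; move: Ay yB; rewrite yE !ltn_pmul2r //; lia.
apply/andP; split; [apply: leq_trans cx | apply: leq_trans xc _]; by rewrite leq_pmul2r.
Qed.

Definition path_inside i j u v s : Prop :=
  exists p, [/\ simple_path T u p v, s <= size p & all (inside i j) (u :: p)].

Lemma midpoint i j u v : ends i.+1 j u v ->
  exists m, ends i j.*2 u m /\ ends i j.*2.+1 m v.
Proof.
case: u v => [u uM] [v vM] [/= uE vE].
have mM : j.*2.+1 * 2 ^ i < M.+1.
  apply: leq_ltn_trans vM; rewrite vE expnS mulnA leq_mul2r; apply/orP; right; lia.
exists (Ordinal mM); rewrite /ends /= uE vE expnS; split; split; nia.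
Qed.

(** The two halves share only [m], so the concatenation stays simple. *)
Lemma path_inside_cat i j u m v s r :
  ends i j.*2 u m -> ends i j.*2.+1 m v ->
  path_inside i j.*2 u m s -> path_inside i j.*2.+1 m v r ->
  path_inside i.+1 j u v (s + r).
Proof.
move=> [uE mE] [_ vE] [p [[up upu] sp pI]] [q [[mq mqu] rq qI]].
exists (p ++ q); split; last 1 first.
- rewrite -cat_cons all_cat; case/andP: qI => _ qI.
  apply/andP; split; [move: pI | move: qI]; apply: sub_all => z;
    rewrite /inside expnS; set Q := 2 ^ i; nia.
- split; first exact: walk_trans up mq.
  have [mnq uq] : m \notin q /\ uniq q by apply/andP.
  rewrite -cat_cons cat_uniq upu uq andbT /=.
  apply/hasPn => z zq; apply: contra mnq => zp.
  have -> : m = z; last by [].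
  apply/val_inj/anti_leq; rewrite /= mE.
  move/allP: pI => /(_ z zp) /andP[_ ->].
  have /andP[+ _] : inside i j.*2.+1 z by move/allP: qI; apply; rewrite inE zq orbT.
  by rewrite andbT.
by rewrite size_cat leq_add.
Qed.

Lemma path_inside_double K :
  (forall j u v, ends K j u v -> path_inside K j u v 1) ->
  forall d j u v, ends (K + d) j u v -> path_inside (K + d) j u v (2 ^ d).
Proof.
move=> base; elim=> [|d IHd] j u v; first by rewrite addn0; apply: base.
rewrite addnS => /midpoint[m [um mv]]; rewrite expnS mul2n -addnn.
by apply: (path_inside_cat um mv); apply: IHd.
Qed.

(* Such paths have length at least [L] because they make a detour outside of
   the interval. *)
Definition detour i j u v L : Prop := forall p, simple_path T u p v ->
  L <= size p /\ exists2 z, z \in u :: p & ~~ inside i j z.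

(** Paths inside both halves would concatenate to one inside the whole interval. So for one half all
    paths leave it, and they pass through the third corner before reaching [m]. *)
Lemma detour_half i j u m v L :
  ends i j.*2 u m -> ends i j.*2.+1 m v -> detour i.+1 j u v L ->
  detour i j.*2 u m L.+1 \/ detour i j.*2.+1 m v L.+1.
Proof.
move=> um mv uv; have [uE mE] := um; have [_ vE] := mv.
have q0 : 0 < 2 ^ i by rewrite expn_gt0.
have eqE (x y : 'I_M.+1) n : y = n :> nat -> x = n :> nat -> x = y.
  by move=> yn xn; apply: val_inj; rewrite /= xn.
have gateO a b : T a b -> ~~ interior i.+1 j a -> interior i.+1 j b -> a = u \/ a = v.
  move=> ab na /(edge_interior ab na)[] aE; [left | right].
    by apply: eqE aE; rewrite uE expnS; nia.
  by apply: eqE aE; rewrite vE expnS; nia.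
have gate1 a b : T a b -> ~~ interior i j.*2 a -> interior i j.*2 b -> a = u \/ a = m.
  by move=> ab na /(edge_interior ab na)[] aE; [left | right]; apply: eqE aE.
have gate2 a b : T a b -> ~~ interior i j.*2.+1 a -> interior i j.*2.+1 b ->
    a = v \/ a = m.
  by move=> ab na /(edge_interior ab na)[] aE; [right | left]; apply: eqE aE.
have Om : interior i.+1 j m by rewrite /interior expnS mE; nia.
have nuv : u != v by rewrite -val_eqE /= uE vE; nia.
have num : u != m by rewrite -val_eqE /= uE mE; nia.
have nvm : v != m by rewrite -val_eqE /= vE mE; nia.
have out k w p : ~ (exists p, simple_path T w p m /\ all (inside i k) (w :: p)) ->
    simple_path T w p m -> exists2 z, z \in w :: p & ~~ inside i k z.
  move=> no wp; apply/allPn; apply/negP => pI.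
  by apply: no; exists p.
have [left_path|no_left] :=
  pselect (exists p, simple_path T u p m /\ all (inside i j.*2) (u :: p)); last first.
  left=> p up; have [z zp zI] := out _ _ _ no_left up; split; last by exists z.
  apply: (@simple_path_detour _ T (interior i.+1 j) (interior i j.*2.+1) v m u p z)
    => //.
  - by move=> a b ab na ba; case: (gateO _ _ ab na ba); auto.
  - by rewrite /interior uE; nia.
  - by rewrite eq_sym.
  - by apply: contra zI => /eqP->; rewrite /inside uE; nia.
  (* Off the left half, [z] is outside the open interval, in the open right half, or equal to
     [v]. *)
  - move: zI; rewrite /inside /interior -val_eqE /= vE expnS; nia.
  - by move=> q /uv[].
have no_right : ~ (exists p, simple_path T v p m /\ all (inside i j.*2.+1) (v :: p)).
  case=> p [/simple_path_rev[q mq qE] pI]; case: left_path => r [ur rI].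
  (* Only the location of the glued path matters, hence the length bounds 0. *)
  have [||s [us _ sI]] := @path_inside_cat i j u m v 0 0 um mv.
  - by exists r.
  - by exists q; split=> //; rewrite qE all_rev.
  by have [_ [z /(allP sI) ->]] := uv s us.
(* Reversal makes the path end at the midpoint, as [simple_path_detour] demands. *)
right=> p /simple_path_rev[q vq qE].
have [z zq zI] := out _ _ _ no_right vq; split; last first.
  by exists z => //; rewrite -mem_rev -qE.
have /= [<-] : size (v :: q) = size (m :: p) by rewrite qE size_rev.
apply: (@simple_path_detour _ T (interior i.+1 j) (interior i j.*2) u m v q z) => //.
- by rewrite /interior vE; nia.
- by apply: contra zI => /eqP->; rewrite /inside vE; nia.
- move: zI; rewrite /inside /interior -val_eqE /= uE expnS; nia.
move=> r /simple_path_rev[s /uv[Ls _] sE].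
by have /= [<-] : size (u :: s) = size (v :: r) by rewrite sE size_rev.
Qed.

(** Each halving lowers the level by one and raises the bound by one, so [L + i] is invariant. *)
Lemma detour_edge i j u v L : ends i j u v -> detour i j u v L ->
  exists a b : 'I_M.+1, dyadic a b /\
    forall p, simple_path T a p b -> L + i <= size p.
Proof.
elim: i j u v L => [|i IHi] j u v L uv far.
  exists u, v; split; last by move=> p /far[]; rewrite addn0.
  by case: uv => -> ->; exists 0, j.
have [m [um mv]] := midpoint uv; rewrite -addSnnS.
case: (detour_half um mv far); [exact: IHi um | exact: IHi mv].
Qed.

Lemma dyadic_distortion K : M = 2 ^ (K + K) -> connected T ->
  exists u v p, [/\ dyadic_graph M u v, simple_path T u p v & K <= size p].
Proof.
move=> ME [_ connT].
have [base|nbase] := pselect (forall j u v, ends K j u v -> path_inside K j u v 1).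
  have uv : ends (K + K) 0 (ord0 : 'I_M.+1) ord_max by split; rewrite ?mul0n ?mul1n.
  have [p [up Kp _]] := path_inside_double base uv.
  exists ord0, ord_max, p; split=> //; last first.
    by apply: leq_trans Kp; apply: ltnW; apply: ltn_expl.
  by apply/asboolP; left; exists (K + K), 0; rewrite mul0n mul1n.
(* The descent starts at level [K] with the trivial bound [L = 0]. *)
have [a [b [ab far]]] : exists a b : 'I_M.+1,
    dyadic a b /\ forall p, simple_path T a p b -> 0 + K <= size p.
  apply: contrapT => nab; apply: nbase => j u v uv; apply: contrapT => nuv.
  apply: nab; apply: (detour_edge uv) => p up; split=> //.
  apply/allPn/negP => pI; apply: nuv; exists p; split=> //.
  (* The ends differ, so the path has the length 1 required by [path_inside]. *)
  case: p up {pI} => // -[[_ /= uE] _]; case: uv; rewrite uE => -> /eqP.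
  by rewrite eqn_pmul2r ?expn_gt0 //; lia.
have [p /simple_path_of_walk[q aq]] := connT a b.
by exists a, b, q; split; rewrite ?(far q aq) //; apply/asboolP; left.
Qed.

End DyadicSubgraph.

Theorem theorem6p1 :
  forall k : int, exists (V : finType) (G : sgraph V),
    [/\ connected G,
        idw G = Fin 1
      & forall T : sgraph V, spanning_tree G T ->
          int_le_enat k (cycle_distortion G T)].
Proof.
(* The absolute value covers negative [k]. Of the [K + K] levels, the upper [K] serve for doubling
   and the lower [K] for halving. *)
move=> k; pose K := `|k|%N; pose M := 2 ^ (K + K).
exists 'I_M.+1, (dyadic_graph M); split.
- exact: dyadic_graph_connected.
- by apply: idw_dyadic_graph; rewrite expn_gt0.
move=> T [[connT _] TG].
have [u [v [p [uv up Kp]]]] := dyadic_distortion TG (erefl : M = 2 ^ (K + K)) connT.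
have : ele (Fin (size p)) (cycle_distortion (dyadic_graph M) T).
  by apply: le_esup; exists u, v, p.
case: cycle_distortion => //= d pd.
apply: Order.POrderTheory.le_trans (ler_norm k) _.
by rewrite -abszE lez_nat (leq_trans Kp).
Qed.
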